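(* Let $w$ be a word with $|w|=n$ and $\mathrm{alph}(w)=\{\mathtt{a},\mathtt{b}\}$, and let $k\ge\iota(w)$ be a positive integer. The minimal number of letter insertions needed to obtain a $k$-universal word (with respect to $\{\mathtt{a},\mathtt{b}\}$) from $w$ can be computed in $O(n)$ time.
   Context: Computational model: unit-cost word RAM. A word $v=v_1\cdots v_\ell$ is a subsequence of $w$ if $w=x_1v_1x_2v_2\cdots x_\ell v_\ell x_{\ell+1}$ for some words $x_i$. A word $u$ is $k$-universal with respect to $\Sigma$ if every word of length $k$ over $\Sigma$ is a subsequence of $u$; $\iota(w)$ is the largest $k$ such that $w$ is $k$-universal with respect to $\mathrm{alph}(w)$. An insertion inserts one letter of the alphabet at some position of the word. *)

(* Defs.v *)
From HB Require Import structures.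
From mathcomp Require Import all_boot.

Set Implicit Arguments.
Unset Strict Implicit.
Unset Printing Implicit Defensive.

(** * Subsequence universality and insertions *)

Section Words.
Variable T : finType.
Implicit Types (A : {set T}) (u v w : seq T).

Definition alph w : {set T} := [set x in w].

Definition universal A (k : nat) u : bool :=
  [forall v : k.-tuple T, [forall x in v, x \in A] ==> subseq v u].

(* A k-universal word over a nonempty alphabet has length at least k, so for
   nonempty w bounding the maximum by size w loses nothing. *)
Definition iota_univ w : nat :=
  \max_(m < (size w).+1 | universal (alph w) m w) m.

Definition insertion A u v : Prop :=
  exists (i : nat) (x : T),
    [/\ i <= size u, x \in A & v = take i u ++ x :: drop i u].

Fixpoint insertions A (d : nat) u v : Prop :=
  if d is d'.+1 then exists2 u', insertion A u u' & insertions A d' u' v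
  else u = v.

Definition min_insertions A (k : nat) w (d : nat) : Prop :=
  (exists2 v, insertions A d w v & universal A k v) /\
  (forall d' v, insertions A d' w v -> universal A k v -> d <= d').

End Words.

(** * Unit-cost word RAM

   Memory cells and registers hold W-bit words, that is, naturals below 2 ^ W,
   and all arithmetic is modulo 2 ^ W.  A program names finitely many
   registers; memory is only reached through addresses held in registers. *)

Inductive binop : Type :=
  | OpAdd | OpSub | OpMul | OpDiv | OpMod | OpAnd | OpOr | OpXor | OpShl | OpShr.

Inductive instr : Type :=
  | IConst (r c : nat)                 (* r <- c *)
  | IMove (r s : nat)                  (* r <- s *)
  | IOp (o : binop) (r s t : nat)      (* r <- s o t *)
  | ILoad (r s : nat)                  (* r <- mem[s] *)
  | IStore (r s : nat)                 (* mem[r] <- s *)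
  | IJump (l : nat)
  | IJumpEq (r s l : nat)              (* if r = s goto l *)
  | IJumpLt (r s l : nat)              (* if r < s goto l *)
  | IHalt.

Definition program := seq instr.

Record state : Type := State { pc : nat; reg : nat -> nat; mem : nat -> nat }.

Definition upd (f : nat -> nat) (i x : nat) : nat -> nat :=
  fun j => if j == i then x else f j.

Definition eval_binop (W : nat) (o : binop) (x y : nat) : nat :=
  match o with
  | OpAdd => x + y
  | OpSub => 2 ^ W + x - y
  | OpMul => x * y
  | OpDiv => x %/ y
  | OpMod => x %% y
  | OpAnd => Nat.land x y
  | OpOr => Nat.lor x y
  | OpXor => Nat.lxor x y
  | OpShl => x * 2 ^ y
  | OpShr => x %/ 2 ^ y
  end %% 2 ^ W.

(* Running past the end of the program halts. *)
Definition fetch (P : program) (s : state) : instr := nth IHalt P (pc s).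

Definition halted (P : program) (s : state) : bool :=
  if fetch P s is IHalt then true else false.

Definition step (W : nat) (P : program) (s : state) : state :=
  let: State p R M := s in
  match fetch P s with
  | IConst r c => State p.+1 (upd R r (c %% 2 ^ W)) M
  | IMove r s => State p.+1 (upd R r (R s)) M
  | IOp o r s t => State p.+1 (upd R r (eval_binop W o (R s) (R t))) M
  | ILoad r s => State p.+1 (upd R r (M (R s))) M
  | IStore r s => State p.+1 R (upd M (R r) (R s))
  | IJump l => State l R M
  | IJumpEq r s l => State (if R r == R s then l else p.+1) R M
  | IJumpLt r s l => State (if R r < R s then l else p.+1) R M
  | IHalt => s
  end.

(* The output is the content of register 0 on halting. *)
Definition halts_within (W : nat) (P : program) (s0 : state) (t y : nat)
    : Prop :=
  exists t', [/\ t' <= t, halted P (iter t' (step W P) s0)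
               & reg (iter t' (step W P) s0) 0 = y].

(** * The binary case *)

Definition letter_a : bool := false.
Definition letter_b : bool := true.

Definition letter_code (x : bool) : nat := if x == letter_a then 1 else 2.

(* Register 0 holds |w|, register 1 holds k, and memory cells 0, ..., |w| - 1
   hold the letters of w; all other registers and cells are 0. *)
Definition input (w : seq bool) (k : nat) : state :=
  State 0 (fun r => nth 0 [:: size w; k] r)
          (fun i => nth 0 (map letter_code w) i).

(* Main.v *)
Require Import Defs.
From mathcomp Require Import all_boot zify.

Set Implicit Arguments.
Unset Strict Implicit.
Unset Printing Implicit Defensive.

(** A binary word is k-universal iff its greedy arch factorization has at least
    k arches.  If w has length n and p <= k arches, the minimal number of
    insertions is max (k - p, 2 k - n).  Lower bound: an insertion adds at most
    one arch, and k arches have total length at least 2 k.  Upper bound: as long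
    as n > 2 p some insertion creates a new arch, and when n = 2 p any insertion
    leads back to that case.  One left-to-right scan computes p. *)

(** * Arches of binary words *)

Local Notation ab := [set letter_a; letter_b] (only parsing).

(* [arches c w] counts the arches completed while scanning [w], where [c] is the
   letter seen so far in the current arch, or [None] at the start of an arch. *)
Fixpoint arches (c : option bool) (w : seq bool) : nat :=
  if w is x :: w' then
    if c is Some y then
      if x == y then arches c w' else (arches None w').+1
    else arches (Some x) w'
  else 0.

(** When the next letter differs from [y], the two scans swap roles: one closes its arch and
    restarts, the other acquires a pending letter. *)
Lemma arches_None_Some y w :
  arches None w <= arches (Some y) w <= (arches None w).+1.
Proof.
elim: w y => [|x w IH] y //=.
have [->|_] := eqVneq x y; first by rewrite leqnn leqnSn.
by have := IH x; lia.
Qed.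

Lemma arches_cons c x w :
  arches c w <= arches c (x :: w) <= (arches c w).+1.
Proof.
case: c => [y|] /=; last exact: arches_None_Some.
case: eqP => _; first by rewrite leqnn leqnSn.
by have := arches_None_Some y w; lia.
Qed.

Lemma arches_insert c u1 x u2 :
  arches c (u1 ++ x :: u2) <= (arches c (u1 ++ u2)).+1.
Proof.
elim: u1 c => [|z u1 IH] c; first by case/andP: (arches_cons c x u2).
rewrite !cat_cons /=; case: c => [y|]; last exact: IH.
by case: eqP => _; rewrite ?ltnS; apply: IH.
Qed.

Lemma arches_size c w :
  (arches c w).*2 <= size w + (c != None).
Proof.
elim: w c => [|x w IH] [y|] //=; last by have := IH (Some x); rewrite /=; lia.
case: eqP => _; first by have := IH (Some y); rewrite /=; lia.
by have := IH None; rewrite /=; lia.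
Qed.

(** Every arch contains both letters, so each supplies one letter of [v]; prepending the pending
    letter completes an arch already begun. *)
Lemma arches_subseq c w v :
  size v <= arches c w -> subseq v (seq_of_opt c ++ w).
Proof.
elim: w c v => [|x w IH] c v; first by case: v => //= *; rewrite sub0seq.
case: c => [y|] /=; last by move/IH.
case: (eqVneq x y) => [->|neq_xy] lev.
  exact: subseq_trans (IH (Some y) v lev) (subseq_cons _ _).
case: v lev => [|z v] //= lev; have sub_v := IH None v lev.
case: (eqVneq z y) => [_|neq_zy].
  exact: subseq_trans sub_v (subseq_cons _ _).
suff -> : z = x by rewrite eqxx.
by case: x y z neq_xy neq_zy {lev} => [] [] [].
Qed.

(* The missing word consists of the last letters of the arches, followed by a
   letter absent from the incomplete last arch. *)
Lemma arches_missing c w :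
  exists v, [/\ size v = (arches c w).+1, ~~ subseq v w
              & if c is Some y then head y v = ~~ y else true].
Proof.
elim: w c => [|x w IH] c.
  by case: c => [y|]; [exists [:: ~~ y] | exists [:: true]].
(* The head condition serves here: a word starting with [~~ y] cannot use a prepended [y]. *)
have skip y : exists v, [/\ size v = (arches (Some y) w).+1,
    ~~ subseq v (y :: w) & head y v = ~~ y].
  have [v [sz nsub hd]] := IH (Some y); exists v; split=> //.
  by case: v sz nsub hd => //= z v _ nsub hd; subst z; case: y nsub.
case: c => [y|] /=; last by have [v [? ? _]] := skip x; exists v.
case: (eqVneq x y) => [->|neq_xy]; first exact: skip.
have [v [sz nsub _]] := IH None.
exists (x :: v); split=> /=; [by rewrite sz | by rewrite eqxx|].
by case: x y neq_xy {skip} => [] [].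
Qed.

Lemma mem_ab x : x \in ab.
Proof. by rewrite !inE; case: x. Qed.

Lemma universal_arches k w : universal ab k w = (k <= arches None w).
Proof.
apply/idP/idP => [/forallP univ|lek]; last first.
  apply/forallP => v; apply/implyP => _.
  by apply: (@arches_subseq None); rewrite size_tuple.
rewrite leqNgt; apply/negP => lt_k.
have [v [sz /negP nsub _]] := arches_missing None w; apply: nsub.
(* Universality speaks of words of length exactly [k], so the missing word is padded. *)
have sz_k : size (v ++ nseq (k - size v) true) == k.
  by rewrite size_cat size_nseq sz subnKC.
have /implyP/(_ _) sub := univ (Tuple sz_k).
apply: subseq_trans (prefix_subseq v _) (sub _).
by apply/forall_inP => x _; apply: mem_ab.
Qed.

(** Turns the hypothesis on [iota_univ w] into the bound that keeps the machine's [k - q] from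
    wrapping. *)
Lemma arches_iota w : alph w = ab -> arches None w <= iota_univ w.
Proof.
move=> alph_w.
have lt_p : arches None w < (size w).+1.
  by have := arches_size None w; rewrite /=; lia.
rewrite /iota_univ (@leq_bigmax_cond _ _ (fun m : 'I_ _ => m : nat)
  (Ordinal lt_p)) //=.
by rewrite alph_w universal_arches.
Qed.

(** * The minimal number of insertions *)

Lemma insertion_cat u1 x u2 : insertion ab (u1 ++ u2) (u1 ++ x :: u2).
Proof.
exists (size u1), x.
by rewrite size_cat leq_addr mem_ab take_size_cat // drop_size_cat.
Qed.

Lemma insertion_split (w v : seq bool) : insertion ab w v ->
  exists u1 x u2, w = u1 ++ u2 /\ v = u1 ++ x :: u2.
Proof.
case=> i [x [_ _ ->]]; exists (take i w), x, (drop i w).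
by rewrite cat_take_drop.
Qed.

Lemma insertions_arches_size d (w v : seq bool) : insertions ab d w v ->
  arches None v <= arches None w + d /\ size v = size w + d.
Proof.
elim: d w => [|d IH] w /=; first by move->; rewrite !addn0.
case=> u /insertion_split[u1 [x [u2 [-> ->]]]] /IH[].
by have := arches_insert None u1 x u2; rewrite !size_cat /=; lia.
Qed.

(** Two-letter arches are stripped until a doubled or a lone letter comes first; the opposite letter
    inserted right after it closes a new arch. *)
Lemma arches_increase w : (arches None w).*2 < size w ->
  exists u1 x u2, w = u1 ++ u2 /\
    arches None (u1 ++ x :: u2) = (arches None w).+1.
Proof.
have [m] := ubnP (size w); elim: m w => // m IH [|x [|y w]] //= sz.
  by move=> _; exists [:: x], (~~ x), [::]; case: x.
case: (eqVneq y x) => [->|neq_yx] lt_w.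
  by exists [:: x], (~~ x), (x :: w); case: (x).
have [||u1 [z [u2 [-> inc]]]] := IH w; [lia | lia|].
by exists [:: x, y & u1], z, u2; rewrite /= (negPf neq_yx) inc.
Qed.

Lemma insertions_exist k d w :
  k <= arches None w + d -> k.*2 <= size w + d ->
  exists2 v, insertions ab d w v & k <= arches None v.
Proof.
elim: d w => [|d IH] w le_k le_2k; first by exists w => //; lia.
have step u1 x u2 : w = u1 ++ u2 -> k <= arches None (u1 ++ x :: u2) + d ->
    exists2 v, insertions ab d.+1 w v & k <= arches None v.
  move=> def_w le_u; have [||v ins_v le_v] := IH (u1 ++ x :: u2) => //.
    by move: le_2k; rewrite def_w !size_cat /=; lia.
  exists v => //; exists (u1 ++ x :: u2) => //.
  by rewrite def_w; apply: insertion_cat.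
have [lt_w|le_w] := ltnP (arches None w).*2 (size w).
  have [u1 [x [u2 [def_w inc]]]] := arches_increase lt_w.
  by apply: (step _ x _ def_w); rewrite inc; lia.
(* With p arches and [size w] at most 2p, 2k <= 2p + d + 1 already gives k <= p + d, so it suffices
   that no arch is lost. *)
apply: (step [::] true w) => //; rewrite cat0s.
by have /andP[] := arches_cons None true w; lia.
Qed.

Lemma min_insertions_maxn k (w : seq bool) :
  min_insertions ab k w (maxn (k - arches None w) (k.*2 - size w)).
Proof.
split=> [|d v /insertions_arches_size[le_v sz_v]].
  have [||v ins_v le_v] := @insertions_exist k
    (maxn (k - arches None w) (k.*2 - size w)) w; [lia | lia|].
  by exists v; rewrite ?universal_arches.
rewrite universal_arches => le_k.
by have := arches_size None v; rewrite /=; lia.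
Qed.

(** * The program *)

(* Registers: 2 = position, 3 = code of the current arch's letter (0 if none),
   4 = completed arches, 5 = letter read, 6 = 1, 7 = 0.  Numbers in comments mark jump
   targets. *)
Definition arch_scan : program :=
  [:: IConst 6 1;
      (* 1 *) IJumpEq 2 0 11;
      ILoad 5 2;
      IOp OpAdd 2 2 6;
      IJumpEq 3 7 9;
      IJumpEq 3 5 1;
      IMove 3 7;
      IOp OpAdd 4 4 6;
      IJump 1;
      (* 9 *) IMove 3 5;
      IJump 1;
      (* 11 *) IOp OpSub 2 1 4;
      IOp OpAdd 3 1 1;
      IJumpLt 3 0 17;
      IOp OpSub 3 3 0;
      IJumpLt 3 2 17;
      IMove 2 3;
      (* 17 *) IMove 0 2].

Ltac run_with facts := repeat (progress rewrite /= /upd /= ?facts /=).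

Definition opt_code (c : option bool) : nat :=
  if c is Some x then letter_code x else 0.

Definition loop_state n k i c q (s : state) (M : nat -> nat) : Prop :=
  Defs.mem s = M
  /\ [/\ reg s 0 = n, reg s 1 = k, reg s 2 = i & reg s 3 = opt_code c]
  /\ [/\ reg s 4 = q, reg s 6 = 1 & reg s 7 = 0].

(** Closing an arch is the longest path, 8 instructions; [q <= i] keeps the counter below
    [2 ^ W]. *)
Lemma arch_scan_iter W n k i c q s M x :
  pc s = 1 -> loop_state n k i c q s M -> M i = letter_code x ->
  i < n -> n < 2 ^ W -> q <= i ->
  exists t, [/\ t <= 8, pc (iter t (step W arch_scan) s) = 1
    & loop_state n k i.+1
        (if c is Some y then if x == y then c else None else Some x)
        (if c is Some y then if x == y then q else q.+1 else q)
        (iter t (step W arch_scan) s) M].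
Proof.
case: s => p R M' /= -> [/= -> [[R0 R1 R2 R3] [R4 R6 R7]]] Mi lt_in lt_nW le_qi.
have Ei : eval_binop W OpAdd i 1 = i.+1 by rewrite /eval_binop modn_small; lia.
have Eq : eval_binop W OpAdd q 1 = q.+1 by rewrite /eval_binop modn_small; lia.
have Ne : (i == n) = false by lia.
have Nz y : (letter_code y == 0) = false by case: y.
have Ncode y z : (letter_code y == letter_code z) = (y == z).
  by case: y z => [] [].
case: c R3 => [y|] /= R3; first case: (eqVneq x y) => [Exy|neq_xy].
- exists 5; rewrite /loop_state.
  run_with (R0,R1,R2,R3,R4,R6,R7,Ne,Mi,Ei,Eq,Nz,Ncode,Exy,eqxx).
  by [].
- exists 8; rewrite /loop_state.
  run_with (R0,R1,R2,R3,R4,R6,R7,Ne,Mi,Ei,Eq,Nz,Ncode,eq_sym y x,negPf neq_xy).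
  by [].
- exists 6; rewrite /loop_state.
  run_with (R0,R1,R2,R3,R4,R6,R7,Ne,Mi,Ei,Eq).
  by [].
Qed.

Lemma arch_scan_loop W n k i c q s M w :
  pc s = 1 -> loop_state n k i c q s M ->
  (forall j, j < size w -> M (i + j) = letter_code (nth true w j)) ->
  i + size w = n -> n < 2 ^ W -> q <= i ->
  exists t, [/\ t <= 8 * size w, pc (iter t (step W arch_scan) s) = 1
    & exists c', loop_state n k n c' (q + arches c w)
                   (iter t (step W arch_scan) s) M].
Proof.
elim: w i c q s => [|x w IH] i c q s pc1 inv memw /= sz lt_nW le_qi.
  move: sz inv; rewrite addn0 => ->.
  by exists 0; split=> //; exists c; rewrite addn0.
have Mi : M i = letter_code x by have := memw 0; rewrite addn0; apply.
have lt_in : i < n by rewrite -sz; lia.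
have [t [le_t pc_t inv_t]] := arch_scan_iter pc1 inv Mi lt_in lt_nW le_qi.
have [||||t' [le_t' pc_t' [c' inv_t']]] := IH _ _ _ _ pc_t inv_t.
- by move=> j lt_j; rewrite addSnnS; apply: (memw j.+1).
- by rewrite -sz addSnnS.
- by [].
- by case: (c) => [y|]; [case: eqP|]; lia.
exists (t' + t); rewrite iterD; split=> //; first by lia.
exists c'; move: inv_t'; case: (c) => [y|] //.
by case: eqP => // _; rewrite addSnnS.
Qed.

(** The test 2k < n comes before the subtraction, which would wrap; in that case the maximum is
    [k - q]. *)
Lemma arch_scan_end W n k c q s M :
  pc s = 1 -> loop_state n k n c q s M ->
  n < 2 ^ W -> k.*2 < 2 ^ W -> q <= k ->
  halts_within W arch_scan s 8 (maxn (k - q) (k.*2 - n)).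
Proof.
case: s => p R M' /= -> [/= -> [[R0 R1 R2 R3] [R4 R6 R7]]] lt_nW lt_kW le_qk.
have Esub x y : y <= x < 2 ^ W -> eval_binop W OpSub x y = x - y.
  case/andP=> le_yx lt_xW; rewrite /eval_binop -(addnBA _ le_yx).
  by rewrite modnDl modn_small //; lia.
have Ekq : eval_binop W OpSub k q = k - q by apply: Esub; lia.
have Ekk : eval_binop W OpAdd k k = k.*2.
  by rewrite /eval_binop addnn modn_small.
have [lt_2kn|le_n2k] := ltnP k.*2 n.
  exists 5; rewrite /halted.
  run_with (R0,R1,R2,R3,R4,R6,R7,eqxx,Ekq,Ekk,lt_2kn).
  by split=> //; lia.
have Ekn : eval_binop W OpSub k.*2 n = k.*2 - n by apply: Esub; lia.
have Nlt : (k.*2 < n) = false by lia.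
have [lt_q|le_q] := ltnP (k.*2 - n) (k - q).
  exists 7; rewrite /halted.
  run_with (R0,R1,R2,R3,R4,R6,R7,eqxx,Ekq,Ekk,Ekn,Nlt,lt_q).
  by split=> //; lia.
have Nltq : (k.*2 - n < k - q) = false by lia.
exists 8; rewrite /halted.
run_with (R0,R1,R2,R3,R4,R6,R7,eqxx,Ekq,Ekk,Ekn,Nlt,Nltq).
by split=> //; lia.
Qed.

Theorem theorem7 :
  exists (P : program) (c C : nat),
  forall (W : nat) (w : seq bool) (k : nat),
    alph w = [set letter_a; letter_b] ->
    0 < k -> iota_univ w <= k ->
    c * (size w + k) <= 2 ^ W ->
    exists d : nat,
      min_insertions [set letter_a; letter_b] k w d /\
      halts_within W P (input w k) (C * size w) d.
Proof.
(* As [k > 0], the factor 3 puts 1, n and 2k strictly below [2 ^ W]. The run takes at most 1 + 8n +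
   8 steps, which is at most 17n since n >= 1. *)
exists arch_scan, 3, 17 => W w k alph_w k_gt0 le_iota le_W.
exists (maxn (k - arches None w) (k.*2 - size w)).
split; first exact: min_insertions_maxn.
have le_p : arches None w <= k := leq_trans (arches_iota alph_w) le_iota.
have w_gt0 : 0 < size w.
  case: w alph_w {le_iota le_W le_p} => // alph0.
  by have := mem_ab true; rewrite -alph0 inE.
set M := nth 0 (map letter_code w).
set s0 := input w k; set s1 := step W arch_scan s0.
have pc1 : pc s1 = 1 by [].
have inv1 : loop_state (size w) k 0 None 0 s1 M.
  by split=> //; split; split=> //=; rewrite /upd /= modn_small //; lia.
have [||||t [le_t pc_t [c inv_t]]] := arch_scan_loop (W := W) (w := w) pc1 inv1.
- by move=> j lt_j; rewrite add0n /M (nth_map true).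
- by [].
- by lia.
- by [].
rewrite add0n in inv_t.
have [||//|t' [le_t' halt_t' out]] := arch_scan_end (W := W) pc_t inv_t.
- by lia.
- by lia.
by exists (t' + (t + 1)); rewrite !iterD; split=> //; lia.
Qed.
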